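(* For every $0<\alpha\le\infty$, $S_{\mathrm{mono}}^{(2)}(-\alpha,\alpha)=\Psi^{(2)}(-\alpha,\alpha)$.
   Context: For a real function $f$ on $(-\alpha,\alpha)$ and a real matrix $A=[a_{ij}]$ with all entries in $(-\alpha,\alpha)$, $f[A]:=[f(a_{ij})]$. For real symmetric matrices, $A\ge0$ means positive semidefinite, and $A\ge B$ means $A-B\ge0$. $S_{\mathrm{mono}}^{(n)}(-\alpha,\alpha)$ is the set of real functions $f$ on $(-\alpha,\alpha)$ such that $A\ge B\ge0$ implies $f[A]\ge f[B]$ for all symmetric $A,B\in M_n(\mathbb{R})$ with entries in $(-\alpha,\alpha)$. $\Phi(0,\alpha)$ is the set of all nonnegative functions $h$ on $(0,\alpha)$ which are non-decreasing and satisfy $h(\sqrt{st})\le\sqrt{h(s)h(t)}$ for all $s,t\in(0,\alpha)$. $\Psi^{(1)}(-\alpha,\alpha)$ is the set of all measurable real functions $g$ on $(-\alpha,\alpha)$ such that $g|_{(0,\alpha)}\in\Phi(0,\alpha)$ and $|g(-t)|\le g(t)$ for Lebesgue-a.e. $t\in(0,\alpha)$. $\Psi^{(2)}(-\alpha,\alpha)$ is the set of all real functions $f$ on $(-\alpha,\alpha)$ for which there exists $g\in\Psi^{(1)}(-\alpha,\alpha)$ such that $f(t)-f(0)=\int_0^tg(s)\,ds$ for all $-\alpha<t<\alpha$. *)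

(* Defs.v *)
From HB Require Import structures.
From mathcomp Require Import all_boot all_order all_algebra.
From mathcomp Require Import all_classical all_reals all_analysis.

Set Implicit Arguments.
Unset Strict Implicit.
Unset Printing Implicit Defensive.

Import Order.TTheory GRing.Theory Num.Theory.
Import numFieldNormedType.Exports.

Local Open Scope classical_set_scope.
Local Open Scope ring_scope.

(* A real function on (-alpha, alpha) is represented by a function R -> R; all
   the classes below constrain only its values on (-alpha, alpha), so that
   membership depends only on the restriction to that interval. *)

Definition sym_itv (R : realType) (alpha : \bar R) : set R :=
  [set x | (- alpha < x%:E < alpha)%E].

Definition pos_itv (R : realType) (alpha : \bar R) : set R :=
  [set x | (0 < x%:E < alpha)%E].

Definition psdmx (R : realType) (n : nat) (A : 'M[R]_n) : Prop :=
  A^T = A /\ forall x : 'cV[R]_n, 0 <= (x^T *m A *m x) 0 0.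

Definition loewner_ge (R : realType) (n : nat) (A B : 'M[R]_n) : Prop :=
  psdmx (A - B).

Definition S_mono (R : realType) (n : nat) (alpha : \bar R) : set (R -> R) :=
  [set f | forall A B : 'M[R]_n,
    A^T = A -> B^T = B ->
    (forall i j, sym_itv alpha (A i j)) ->
    (forall i j, sym_itv alpha (B i j)) ->
    loewner_ge A B -> psdmx B ->
    loewner_ge (map_mx f A) (map_mx f B)].

Definition Phi (R : realType) (alpha : \bar R) : set (R -> R) :=
  [set h | [/\ forall s, pos_itv alpha s -> 0 <= h s,
      forall s t, pos_itv alpha s -> pos_itv alpha t -> s <= t -> h s <= h t
    & forall s t, pos_itv alpha s -> pos_itv alpha t ->
        h (Num.sqrt (s * t)) <= Num.sqrt (h s * h t)]].

(* R with the sigma-algebra of Lebesgue-measurable sets, i.e. the domain of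
   completed_lebesgue_measure; the default sigma-algebra on R is Borel. *)
Definition lebesgue_type (R : realType) :=
  caratheodory_type (mu_ext (@wlength R idfun)).

Definition Psi1 (R : realType) (alpha : \bar R) : set (R -> R) :=
  [set g : R -> R | [/\ measurable_fun (sym_itv alpha : set (lebesgue_type R))
        (g : lebesgue_type R -> R),
      Phi alpha g
    & {ae @completed_lebesgue_measure R, forall t : R,
        pos_itv alpha t -> `|g (- t)| <= g t}]].

Definition oriented_integral (R : realType) (g : R -> R) (t : R) : \bar R :=
  if 0 <= t then (\int[@completed_lebesgue_measure R]_(s in `[0%R, t]) (g s)%:E)%E
  else (- \int[@completed_lebesgue_measure R]_(s in `[t, 0%R]) (g s)%:E)%E.

(* For g in Psi1 the integral is automatically finite, g being almost everywhere
   bounded on compact subintervals; stating the equality in \bar R avoids any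
   default value. *)
Definition Psi2 (R : realType) (alpha : \bar R) : set (R -> R) :=
  [set f | exists2 g : R -> R, Psi1 alpha g &
    forall t, sym_itv alpha t -> (f t - f 0)%:E = oriented_integral g t].

(* Main.v *)
Require Import Defs.
From HB Require Import structures.
From mathcomp Require Import all_boot all_order all_algebra.
From mathcomp Require Import all_classical all_reals all_analysis.
From mathcomp Require Import measurable_realfun.
From mathcomp Require Import ring lra.

(** A symmetric 2 x 2 matrix is psd when its diagonal is nonnegative and one
quadratic inequality holds, so [f] preserves the Loewner order on psd matrices exactly when
the increments [u], [v], [w] of [f] along the entries of [A >= B >= 0] satisfy
[u, v >= 0] and [w ^+ 2 <= u * v] ([S_mono2P], [increment_psd]).  Both
inclusions are about this increment condition.

From monotonicity to an integral.  For [A] and [B] with constant diagonals the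
condition gives
[`|f (c + eta) - f c| <= f (d + eps) - f d] whenever [`|c| <= d] and
[`|eta| <= eps] ([increment_le]).  Increments over equal steps hence grow to the
right, and comparing many steps of length [eps] near [T] with one fixed
increment beyond [T] shows that [f] is Lipschitz on [[-T, T]] for every
[T < alpha] ([increment_psd_lipschitz]).  A Lipschitz function is the integral
of its almost everywhere limit of difference quotients: after adding a linear
term it is nondecreasing, its Stieltjes measure is absolutely continuous, and
the Radon-Nikodym density is recovered by Lebesgue differentiation
([lipschitz_density_quotient]).  The density is taken to be the limsup [g] of
the forward quotients with steps [2 ^- n].  On [x > 0] these quotients are
nonincreasing in [n], so they converge everywhere; the monotonicity of [g], the
inequality [g (sqrt (s * t)) <= sqrt (g s * g t)] and
[`|g (- t)| <= g t] are then limits of increment inequalities.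

From an integral to monotonicity.  Only two consequences of
[f t - f 0 = \int_0^t g] are used: [f] has Lipschitz constant [g m] on
[[-m, m]], and [f y - f x >= c * (y - x)] when [g >= c >= 0] on []x, y]] with
[0 <= x] ([primitive_lipschitz], [primitive_increment_ge]).  Along the segment
from [B] to [A], cut into [N] equal pieces, the off-diagonal increment on one
piece is controlled by the value of [g] at the geometric mean of the diagonal
entries at its right end, hence by the diagonal increments on the next piece.
These 2 x 2 inequalities add up because sums of psd matrices are psd, and
letting [N] grow gives the claim ([integrated_Phi_increment_psd]). *)

Set Implicit Arguments.
Unset Strict Implicit.
Unset Printing Implicit Defensive.

Import Order.TTheory GRing.Theory Num.Theory.
Import numFieldNormedType.Exports.

Local Open Scope classical_set_scope.
Local Open Scope ring_scope.

(** * Positive semidefinite 2 x 2 matrices and increments *)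

Lemma psdmx2P (R : realType) (A : 'M[R]_2) :
  psdmx A <-> [/\ A^T = A, 0 <= A 0 0, 0 <= A 1 1 & A 0 1 ^+ 2 <= A 0 0 * A 1 1].
Proof.
have quad (x : 'cV[R]_2) : A^T = A -> (x^T *m A *m x) 0 0 =
    A 0 0 * x 0 0 ^+ 2 + 2 * A 0 1 * (x 0 0 * x 1 0) + A 1 1 * x 1 0 ^+ 2.
  move=> As; rewrite !mxE !big_ord_recl big_ord0 !mxE !big_ord_recl !big_ord0 !mxE.
  have -> : A (lift ord0 ord0) ord0 = A 0 1 by rewrite -[in LHS]As mxE; congr (A _ _); apply/val_inj.
  have -> : lift ord0 ord0 = 1 :> 'I_2 by apply/val_inj.
  have -> : ord0 = 0 :> 'I_2 by apply/val_inj.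
  by ring.
split=> [[As A0]|[As a0 d0 bb]].
- have q (u v : R) : 0 <= A 0 0 * u ^+ 2 + 2 * A 0 1 * (u * v) + A 1 1 * v ^+ 2.
    by have := A0 (\col_i if i == 0 then u else v); rewrite quad// !mxE.
  have a0 : 0 <= A 0 0 by have := q 1 0; lra.
  have d0 : 0 <= A 1 1 by have := q 0 1; lra.
  split=> //.
  have [az|an] := eqVneq (A 0 0) 0.
    rewrite az mul0r.
    (* the form is affine in the first coordinate, so nonnegative only if
       it is constant in it *)
    have := q (- (A 1 1 + 1)) (A 0 1); rewrite az; nra.
  have ap : 0 < A 0 0 by rewrite lt_neqAle eq_sym an.
  (* the vector minimizing the form for a fixed second coordinate *)
  have := q (- A 0 1) (A 0 0).
  rewrite (_ : _ + _ = A 0 0 * (A 0 0 * A 1 1 - A 0 1 ^+ 2)); last by ring.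
  by rewrite pmulr_rge0// subr_ge0.
- split=> // x; rewrite quad//.
  move: (A 0 0) (A 0 1) (A 1 1) (x 0 0) (x 1 0) a0 d0 bb => a b d u v a0 d0 bb.
  have [az|an] := eqVneq a 0.
    move: bb; rewrite az mul0r => bb.
    have -> : b = 0 by apply/eqP; rewrite -sqrf_eq0 eq_le bb sqr_ge0.
    by rewrite mul0r mulr0 mul0r !add0r mulr_ge0// sqr_ge0.
  have ap : 0 < a by rewrite lt_neqAle eq_sym an.
  rewrite -(pmulr_rge0 _ ap).
  rewrite [leRHS](_ : _ = (a * u + b * v) ^+ 2 + (a * d - b ^+ 2) * v ^+ 2); last by ring.
  by rewrite addr_ge0 ?sqr_ge0// mulr_ge0 ?sqr_ge0// subr_ge0.
Qed.

(** For [A = B + P] with [B] of entries [b1], [c], [b2] and [P] of entries [p],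
[r], [q], this says that [f[A] - f[B]] is psd.  Only the diagonal of [A] has to
be required in the interval: it bounds all the other entries. *)
Definition increment_psd (R : realType) (alpha : \bar R) (f : R -> R) :=
  forall b1 b2 c p q r : R,
    0 <= b1 -> 0 <= b2 -> c ^+ 2 <= b1 * b2 ->
    0 <= p -> 0 <= q -> r ^+ 2 <= p * q ->
    sym_itv alpha (b1 + p) -> sym_itv alpha (b2 + q) ->
    [/\ f b1 <= f (b1 + p), f b2 <= f (b2 + q) &
     (f (c + r) - f c) ^+ 2 <= (f (b1 + p) - f b1) * (f (b2 + q) - f b2)].

Lemma sym_itvP (R : realType) (alpha : \bar R) (x : R) :
  sym_itv alpha x <-> (`|x|%:E < alpha)%E.
Proof.
rewrite /sym_itv/=; case: alpha => [a| |]/=.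
- by rewrite !lte_fin ltr_norml.
- by rewrite !ltry ltNyr.
- by split.
Qed.

Lemma sym_itvS (R : realType) (alpha : \bar R) (x y : R) :
  `|x| <= `|y| -> sym_itv alpha y -> sym_itv alpha x.
Proof. by move=> xy /sym_itvP ya; apply/sym_itvP; apply: le_lt_trans ya; rewrite lee_fin. Qed.

Lemma norm_geomean_le_max (R : realType) (c b1 b2 : R) :
  0 <= b1 -> 0 <= b2 -> c ^+ 2 <= b1 * b2 -> `|c| <= Num.max b1 b2.
Proof.
move=> b10 b20 cb; rewrite -(@ler_pXn2r _ 2)// ?nnegrE ?normr_ge0//; last first.
  by rewrite le_max b10.
rewrite real_normK ?num_real// (le_trans cb)// expr2.
by rewrite ler_pM// le_max lexx ?orbT.
Qed.

Lemma sym_itv_geomean (R : realType) (alpha : \bar R) (x y z : R) :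
  sym_itv alpha x -> sym_itv alpha y -> 0 <= x -> 0 <= y ->
  z ^+ 2 <= x * y -> sym_itv alpha z.
Proof.
move=> xa ya x0 y0 zxy; have := norm_geomean_le_max x0 y0 zxy.
rewrite le_max => /orP[]h; [move: xa|move: ya]; apply: sym_itvS;
  by rewrite (le_trans h)// ler_norm.
Qed.

(** The sum of two psd matrices is psd: the cross terms are dominated by the
arithmetic-geometric mean inequality. *)
Lemma psd2D (R : realType) (a b c p q r : R) :
  0 <= a -> 0 <= b -> c ^+ 2 <= a * b ->
  0 <= p -> 0 <= q -> r ^+ 2 <= p * q -> (c + r) ^+ 2 <= (a + p) * (b + q).
Proof.
move=> a0 b0 cab p0 q0 rpq.
have cr : 2 * (c * r) <= a * q + p * b.
  rewrite (le_trans (ler_norm _))// -(@ler_pXn2r _ 2)// ?nnegrE ?normr_ge0//; last first.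
    by rewrite addr_ge0// mulr_ge0.
  rewrite real_normK ?num_real//.
  rewrite (_ : _ ^+ 2 = 4 * (c ^+ 2 * r ^+ 2)); last by ring.
  apply: (@le_trans _ _ (4 * ((a * b) * (p * q)))).
    by rewrite ler_pM2l// ler_pM// sqr_ge0.
  rewrite -subr_ge0 (_ : _ - _ = (a * q - p * b) ^+ 2) ?sqr_ge0//; ring.
by rewrite -subr_ge0; nra.
Qed.

Lemma S_mono2P (R : realType) (alpha : \bar R) (f : R -> R) :
  S_mono 2 alpha f <-> increment_psd alpha f.
Proof.
split=> [fS b1 b2 c p q r b10 b20 cb p0 q0 rpq b1pa b2qa|fi A B As Bs Aa Ba AB B0].
- pose mk (x y z : R) : 'M[R]_2 := \matrix_(i, j) if i == j then (if i == 0 then x else y) else z.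
  have mks x y z : (mk x y z)^T = mk x y z.
    by apply/matrixP => i j; rewrite !mxE eq_sym; case: eqP => // ->.
  have mk00 x y z : mk x y z 0 0 = x by rewrite mxE.
  have mk11 x y z : mk x y z 1 1 = y by rewrite mxE.
  have mk01 x y z : mk x y z 0 1 = z by rewrite mxE.
  have crpq := psd2D b10 b20 cb p0 q0 rpq.
  have mka x y z : sym_itv alpha x -> sym_itv alpha y -> sym_itv alpha z ->
      forall i j, sym_itv alpha (mk x y z i j).
    by move=> xa ya za i j; rewrite mxE; do 2?case: ifP => _.
  have b1a : sym_itv alpha b1.
    by apply: sym_itvS b1pa; rewrite !ger0_norm ?addr_ge0// lerDl.
  have b2a : sym_itv alpha b2.
    by apply: sym_itvS b2qa; rewrite !ger0_norm ?addr_ge0// lerDl.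
  have := fS (mk (b1 + p) (b2 + q) (c + r)) (mk b1 b2 c) (mks _ _ _) (mks _ _ _).
  move=> /(_ (mka _ _ _ _ _ _) (mka _ _ _ _ _ _))[]//.
  + by apply: sym_itv_geomean crpq => //; rewrite addr_ge0.
  + exact: sym_itv_geomean cb.
  + apply/psdmx2P; split.
    * by rewrite linearB/= !mks.
    * by rewrite mxE mk00 mxE mk00; lra.
    * by rewrite mxE mk11 mxE mk11; lra.
    * by rewrite !(mxE, mk00, mk11, mk01)/=; nra.
  + by apply/psdmx2P; rewrite mks mk00 mk11 mk01.
  move=> s0 h0; have /psdmx2P[_] : psdmx (map_mx f (mk (b1 + p) (b2 + q) (c + r)) - map_mx f (mk b1 b2 c)) by [].
  by rewrite !(mxE, mk00, mk11, mk01)/= !subr_ge0.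
- have /psdmx2P[_] := AB; rewrite !mxE !subr_ge0 => A00 A11 A01.
  have /psdmx2P[_ B00 B11 B01] := B0.
  have := fi (B 0 0) (B 1 1) (B 0 1) (A 0 0 - B 0 0) (A 1 1 - B 1 1) (A 0 1 - B 0 1).
  rewrite !subr_ge0 !(addrC (B _ _)) !subrK.
  move=> /(_ B00 B11 B01 A00 A11 A01 (Aa 0 0) (Aa 1 1))[f00 f11 f01].
  apply/psdmx2P; rewrite !mxE !subr_ge0; split=> //.
  by rewrite linearB/= !map_trmx As Bs.
Qed.

(** * Symmetric intervals *)

Section symmetric_interval.
Context {R : realType} (alpha : \bar R).

Lemma sym_itv_room x : sym_itv alpha x -> exists2 T, `|x| < T & sym_itv alpha T.
Proof.
move=> /sym_itvP; case: alpha => [a| |]//; rewrite ?lte_fin => xa.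
- exists ((`|x| + a) / 2); first lra.
  by apply/sym_itvP; rewrite lte_fin ger0_norm; have := normr_ge0 x; lra.
- by exists (`|x| + 1); [lra|apply/sym_itvP; rewrite ltry].
Qed.

Lemma open_sym_itv : open (sym_itv alpha).
Proof.
rewrite openE => x xa; have [T xT Ta] := sym_itv_room xa.
exists (T - `|x|); first by rewrite /= subr_gt0.
move=> y /= xy; apply: sym_itvS Ta; rewrite (le_trans _ (ler_norm _))//.
rewrite -(subrK x y) (le_trans (ler_normD _ _))// distrC.
by move: xy; lra.
Qed.

(** Turns statements on each [[-T, T]] into countably many, so that exceptional
null sets can be united. *)
Lemma sym_itv_exhaustion : (0 < alpha)%E -> exists2 T : nat -> R,
  forall k, 0 <= T k /\ sym_itv alpha (T k) &
  forall x, sym_itv alpha x -> exists k, `|x| < T k.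
Proof.
case: alpha => [a| |]// a0; last first.
  exists (fun k => k%:R) => [k|x _]; first by rewrite ler0n; split=> //; apply/sym_itvP; rewrite ltry.
  exists (Num.trunc `|x|).+1.
  by have /andP[] := trunc_itv (normr_ge0 x).
rewrite lte_fin in a0.
have T0 k : 0 <= a - a / k.+1%:R.
  by rewrite subr_ge0 ler_pdivrMr// ler_peMr ?ler1n// ltW.
exists (fun k => a - a / k.+1%:R) => [k|x /sym_itvP].
  split=> //; apply/sym_itvP; rewrite ger0_norm// lte_fin.
  by rewrite ltrBlDr ltrDl divr_gt0.
rewrite lte_fin => xa; have ax : 0 < a - `|x| by rewrite subr_gt0.
exists (Num.trunc (a / (a - `|x|))).
have /andP[_] := trunc_itv (divr_ge0 (ltW a0) (ltW ax)).
by rewrite ltr_pdivrMr// [ltRHS]mulrC -ltr_pdivrMr//= !ltrBrDr addrC.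
Qed.

End symmetric_interval.

(** * Local Lipschitz bounds *)

Section increments.
Context {R : realType} (alpha : \bar R) (f : R -> R).
Hypothesis f_psd : increment_psd alpha f.

(** The case of constant diagonals, [B] with entries [d], [c] and [A - B] with
entries [eps], [eta]: both diagonal increments coincide. *)
Lemma increment_le c d eta eps : `|c| <= d -> `|eta| <= eps ->
  sym_itv alpha (d + eps) -> `|f (c + eta) - f c| <= f (d + eps) - f d.
Proof.
move=> cd etaeps da.
have d0 : 0 <= d := le_trans (normr_ge0 _) cd.
have eps0 : 0 <= eps := le_trans (normr_ge0 _) etaeps.
have sq_le (x y : R) : `|x| <= y -> x ^+ 2 <= y * y.
  by move=> xy; rewrite -real_normK ?num_real// expr2 ler_pM.
have [fd _] := f_psd d0 d0 (sq_le _ _ cd) eps0 eps0 (sq_le _ _ etaeps) da da.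
rewrite -expr2 -[_ ^+ 2 in leLHS]real_normK ?num_real//.
by rewrite ler_pXn2r// ?nnegrE// subr_ge0.
Qed.

(** Increments of [f] over steps of length [eps] are nondecreasing, so the first
one is at most the average of [k] consecutive ones. *)
Lemma increments_sum_le d eps k : 0 <= d -> 0 <= eps ->
  sym_itv alpha (d + eps *+ k) ->
  (f (d + eps) - f d) *+ k <= f (d + eps *+ k) - f d.
Proof.
move=> d0 eps0; elim: k => [|k IH] da; first by rewrite !mulr0n addr0 subrr.
rewrite mulrSr (le_trans (lerD (IH _) (le_refl _)))//.
  apply: sym_itvS da.
  rewrite !ger0_norm ?addr_ge0 ?mulrn_wge0//.
  by rewrite lerD2l [leRHS]mulrS lerDr.
have dk : `|d| <= d + eps *+ k by rewrite ger0_norm// lerDl mulrn_wge0.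
have ee : `|eps| <= eps by rewrite ger0_norm.
rewrite mulrSr addrA in da *.
by have := le_trans (ler_norm _) (increment_le dk ee da); lra.
Qed.

(** Choose [T'] beyond [T].  A step of length [eps] inside [[-T, T]] increases
[f] by no more than the step from [T] to [T + eps] does, and about
[(T' - T) / eps] such steps fit before [T'], each increasing [f] by at least as
much, with total at most [f T' - f T].  For [x] and [y] further apart than
[T' - T] the oscillation of [f] on [[-T, T]] suffices. *)
Lemma increment_psd_lipschitz T : 0 <= T -> sym_itv alpha T ->
  exists2 L, 0 <= L &
    forall x y, `|x| <= T -> `|y| <= T -> `|f x - f y| <= L * `|x - y|.
Proof.
move=> T0 Ta.
have [T' + T'a] := sym_itv_room Ta; rewrite ger0_norm// => TT'.
have f_le x : `|x| <= T -> `|f x - f 0| <= f T - f 0.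
  move=> xT; have := @increment_le 0 0 x T.
  by rewrite !add0r normr0; apply.
pose M := f T' - f T; pose N := f T - f 0; pose del := T' - T.
have del0 : 0 < del by rewrite subr_gt0.
have N0 : 0 <= N by apply: le_trans (f_le 0 _) => //; rewrite normr0.
have M0 : 0 <= M.
  have TE : T + del = T' by rewrite /del; ring.
  have := @increment_le T T 0 del; rewrite TE normr0 ger0_norm//.
  by move=> /(_ (lexx _) (ltW del0) T'a); apply: le_trans.
exists (2 * (M + N) / del).
  by rewrite divr_ge0 ?(ltW del0)// mulr_ge0// addr_ge0.
move=> x y xT yT; set eps := `|x - y|.
have [eps0|eps0] := eqVneq eps 0.
  by move/eqP: (eps0); rewrite normr_eq0 subr_eq0 => /eqP ->; rewrite subrr normr0 eps0 mulr0.
have {}eps0 : 0 < eps by rewrite lt_neqAle eq_sym eps0 normr_ge0.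
have [epsd|epsd] := leP eps del; last first.
  apply: (@le_trans _ _ (2 * N)).
    rewrite (_ : f x - f y = (f x - f 0) - (f y - f 0)); last by ring.
    by rewrite (le_trans (ler_normB _ _))// mulr2n mulrDl mul1r lerD// f_le.
  rewrite mulrAC ler_pdivlMr//.
  have : 2 * (M + N) * del <= 2 * (M + N) * eps.
    by rewrite ler_wpM2l ?(ltW epsd)// mulr_ge0// addr_ge0.
  apply: le_trans; rewrite ler_wpM2r ?(ltW del0)//; lra.
(* the number of steps of length [eps] that fit between [T] and [T'] *)
pose k := Num.trunc (del / eps).
have /andP[kd dk] : k%:R <= del / eps < k.+1%:R.
  by apply: trunc_itv; rewrite divr_ge0// ltW.
have k1 : 1 <= k%:R :> R.
  by rewrite ler1n trunc_gt0 ler_pdivlMr// mul1r.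
have key : (f (T + eps) - f T) * k%:R <= M.
  rewrite mulr_natr (le_trans (increments_sum_le _ _ _))//; first exact: ltW.
    apply: sym_itvS T'a; rewrite !ger0_norm ?addr_ge0 ?mulrn_wge0 ?(ltW eps0)//; last first.
      by rewrite (le_trans T0) ?ltW.
    by rewrite -mulr_natl -lerBrDl -/del -ler_pdivlMr.
  have e0 : 0 <= del - eps *+ k by rewrite subr_ge0 -mulr_natl -ler_pdivlMr.
  have T'E : T' = T + eps *+ k + (del - eps *+ k) by rewrite /del; ring.
  have nT : `|T + eps *+ k| <= T + eps *+ k.
    by rewrite ger0_norm// addr_ge0// mulrn_wge0// ltW.
  have ne : `|0 : R| <= del - eps *+ k by rewrite normr0.
  move: (T'a); rewrite [X in sym_itv _ X]T'E => /(increment_le nT ne).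
  by rewrite -T'E /M => /(le_trans (normr_ge0 _)); rewrite subr_ge0 lerD2r.
have fxy : `|f x - f y| <= f (T + eps) - f T.
  rewrite -[in f x](subrK y x) [x - y + y]addrC.
  apply: increment_le => //; apply: sym_itvS T'a.
  by rewrite !ger0_norm; rewrite /del in epsd; lra.
apply: (le_trans fxy).
set u := f (T + eps) - f T in key fxy *.
have u0 : 0 <= u by apply: le_trans fxy.
rewrite mulrAC ler_pdivlMr//.
have : del <= eps * (2 * k%:R).
  move: dk; rewrite ltr_pdivrMr// -natr1 => dk.
  by apply: (le_trans (ltW dk)); rewrite mulrC ler_pM2l//; lra.
move=> h; apply: (@le_trans _ _ (u * (eps * (2 * k%:R)))).
  by rewrite ler_wpM2l.
have : u * k%:R * (2 * eps) <= (M + N) * (2 * eps).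
  by rewrite ler_wpM2r// ?mulr_ge0 ?(ltW eps0)//; lra.
by lra.
Qed.

End increments.

(** * Densities of Lipschitz functions *)

Section lipschitz_density.
Context {R : realType}.
Local Notation mu := (@lebesgue_measure R).

(** Any cover by intervals of small total length has small total [G]-length. *)
Lemma lipschitz_stieltjes_null (G : cumulative R R) (L : R) : 0 < L ->
  (forall x y, x <= y -> G y - G x <= L * (y - x)) ->
  forall A, mu A = 0%E -> lebesgue_stieltjes_measure G A = 0%E.
Proof.
move=> L0 GL A A0; apply/eqP; rewrite eq_le measure_ge0 andbT.
apply/lee_addgt0Pr => e e0; rewrite add0e.
have A_fin : ereal_inf [set \sum_(0 <= k <oo) wlength idfun (B k) | B in
    @measurable_cover _ (ocitv_type R) A]%E \is a fin_num.
  by rewrite [X in X \is a _]A0.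
have eL0 : 0 < e / L by rewrite divr_gt0.
have [_ [B [mB AB] <-]] := lb_ereal_inf_adherent eL0 A_fin.
rewrite [X in (_ < X + _)%E]A0 add0e => Be.
apply: (@le_trans _ _ (\sum_(0 <= k <oo) wlength G (B k))%E).
  by apply: ereal_inf_lbound; exists B.
apply: (@le_trans _ _ (\sum_(0 <= k <oo) (L%:E * wlength idfun (B k)))%E).
  apply: lee_nneseries => [k _ _|k _]; first exact: wlength_ge0.
  have [[x y] _ <-] := mB k.
  rewrite !wlength_itv /= lte_fin; case: ifPn => xy; last by rewrite mule0.
  by rewrite -!EFinB -EFinM lee_fin GL// ltW.
rewrite nneseriesZl; last by move=> k _; exact: wlength_ge0.
by rewrite muleC -lee_pdivlMr// ltW.
Qed.

(** Radon-Nikodym for the Stieltjes measure of [F] restricted to []a, b]].  The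
last clause is the form to which Lebesgue differentiation applies. *)
Lemma lipschitz_density (F : R -> R) (L a b : R) : 0 < L -> a <= b ->
  {homo F : x y / x <= y} ->
  (forall x y, x <= y -> F y - F x <= L * (y - x)) ->
  exists phi : R -> R, [/\ mu.-integrable setT (EFin \o phi),
    forall x y, a <= x -> x <= y -> y <= b ->
      (\int[mu]_(s in `[x, y]) (phi s)%:E)%E = (F y - F x)%:E &
    forall x, a <= x -> x <= b ->
      \int[mu]_(s in [set` `]-oo, x]]) phi s = F x - F a].
Proof.
move=> L0 ab ndF FL.
have rcF : right_continuous F.
  apply: right_continuousW => x; apply/cvgrPdist_lt => e e0.
  have FLn u v : `|F u - F v| <= L * `|u - v|.
    wlog uv : u v / v <= u => [h|].
      by have [/h//|/ltW/h] := leP v u; rewrite distrC [in X in _ <= X -> _]distrC.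
    by rewrite !ger0_norm ?subr_ge0 ?ndF// FL.
  near=> y; apply: (le_lt_trans (FLn _ _)).
  rewrite -ltr_pdivlMl//.
  by near: y; exists (L^-1 * e) => //=; rewrite mulr_gt0// invr_gt0.
have [G GF] : exists G : cumulative R R, G = F :> (R -> R).
  pose G : cumulative R R := HB.pack F (isCumulative.Build R _ R F ndF rcF).
  by exists G.
have GL x y : x <= y -> G y - G x <= L * (y - x) by rewrite GF; exact: FL.
(* restricting to [D] makes the Stieltjes measure finite *)
pose D : set (measurableTypeR R) := `]a, b]%classic.
have mD : measurable D by exact: measurable_itv.
have GE (x y : R) : x <= y -> lebesgue_stieltjes_measure G `]x, y]%classic = (F y - F x)%:E.
  move=> xy; transitivity (wlength G `]x, y]%classic).
    by apply: measurable_mu_extE; exact: is_ocitv.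
  by rewrite wlength_itv_bnd// GF.
have Dfin : (lebesgue_stieltjes_measure G D < +oo)%E by rewrite GE// ltry.
pose nu : {finite_measure set _ -> \bar R} := mfrestr mD Dfin.
have nuE A : nu A = lebesgue_stieltjes_measure G (A `&` D) by [].
have nu_mu : nu `<< mu.
  apply/null_content_dominatesP => A mA A0; rewrite nuE.
  apply: (lipschitz_stieltjes_null L0 GL) => //.
  by apply: subset_measure0 A0 => //; apply: measurableI.
have [phi [phi0 phifin phii phiE]] := radon_nikodym_sigma_finite nu_mu.
have phiEF : EFin \o (fine \o phi) = phi by apply/funext => x /=; rewrite fineK.
have nu_itv x y : a <= x -> x <= y -> y <= b -> nu `]x, y]%classic = (F y - F x)%:E.
  move=> ax xy yb; rewrite nuE setIidl ?GE// => z; rewrite /D/= !in_itv/=.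
  by move=> /andP[xz zy]; rewrite (le_lt_trans ax xz) (le_trans zy yb).
exists (fine \o phi); split.
- by rewrite phiEF.
- move=> x y ax xy yb; rewrite -nu_itv// phiE; last exact: measurable_itv.
  under eq_integral do rewrite /= fineK//.
  rewrite integral_itv_obnd_cbnd//.
  by apply: measurable_funS (measurable_int _ phii).
- move=> x ax xb; rewrite /Rintegral.
  under eq_integral do rewrite /= fineK//.
  rewrite -phiE ?nuE; last exact: measurable_itv.
  rewrite (_ : _ `&` D = `]a, x]%classic) ?GE//.
  apply/seteqP; split=> z; rewrite /D/= !in_itv/=.
    by move=> [zx /andP[-> _]].
  by move=> /andP[az zx]; split=> //; rewrite az (le_trans zx).
Unshelve. all: by end_near. Qed.

End lipschitz_density.

Section dyadic_quotient.
Context {R : realType}.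
Local Notation mu := (@lebesgue_measure R).

(** Dyadic steps, since halving the step is what makes the forward quotients of a
midpoint convex function comparable. *)
Definition dyadic_step (n : nat) : R := 2^-1 ^+ n.

Definition dyadic_quotient (f : R -> R) (x : R) (n : nat) : R :=
  (dyadic_step n)^-1 * (f (x + dyadic_step n) - f x).

Lemma dyadic_step_gt0 n : 0 < dyadic_step n.
Proof. by rewrite /dyadic_step exprn_gt0// invr_gt0. Qed.

Lemma cvg_dyadic_step : dyadic_step n @[n --> \oo] --> (0 : R).
Proof. by apply: cvg_expr; rewrite ger0_norm ?invr_ge0// invf_lt1// ltr1n. Qed.

Lemma near_dyadic_step (e : R) : 0 < e -> \forall n \near \oo, dyadic_step n < e.
Proof.
move=> e0; have /cvgrPdist_lt/(_ _ e0) := cvg_dyadic_step.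
by apply: filterS => n; rewrite sub0r normrN gtr0_norm// dyadic_step_gt0.
Qed.

Lemma derivable_dyadic_quotient (f : R -> R) x : derivable f x 1 ->
  dyadic_quotient f x n @[n --> \oo] --> derive1 f x.
Proof.
move=> fx.
have fx' : h^-1 *: (f (h + x) - f x) @[h --> 0^'] --> derive1 f x.
  move: fx; rewrite /derivable /derive1.
  rewrite (_ : (fun h : R => h^-1 *: ((f \o shift x) (h *: (1 : R)) - f x)) =
               (fun h => h^-1 *: (f (h + x) - f x)))//.
  by apply/funext => h /=; rewrite [h%:A](mulr1).
have step0 n : dyadic_step n != 0 by rewrite gt_eqF// dyadic_step_gt0.
have [/(_ fx') fP _] := cvgr_dnbhsP (fun h : R => h^-1 *: (f (h + x) - f x)) 0 (derive1 f x).
have := fP _ (conj step0 cvg_dyadic_step).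
by apply: cvg_trans; apply: near_eq_cvg; near=> n; rewrite [_ + x]addrC.
Unshelve. all: by end_near. Qed.

(** [f] is extended by clamping its argument to [[-T, T]] and made nondecreasing
by adding [(L + 1) * x]; the Radon-Nikodym density of the result, minus
[L + 1], is the density of [f], and the first fundamental theorem for Lebesgue
integrals identifies it with the limit of quotients. *)
Lemma lipschitz_density_quotient (f : R -> R) (L T : R) : 0 <= L -> 0 <= T ->
  (forall x y, `|x| <= T -> `|y| <= T -> `|f x - f y| <= L * `|x - y|) ->
  exists psi : R -> R, [/\ measurable_fun setT psi,
    forall x y, - T <= x -> x <= y -> y <= T ->
      (\int[mu]_(s in `[x, y]) (psi s)%:E)%E = (f y - f x)%:E &
    {ae mu, forall x, `|x| < T ->
      dyadic_quotient f x n @[n --> \oo] --> psi x}].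
Proof.
move=> L0 T0 fL; pose L' := L + 1.
have NTT : - T <= T by rewrite (le_trans _ T0)// oppr_le0.
(* the projection onto [[-T, T]] *)
pose c (x : R) := Num.max (- T) (Num.min x T).
have cT x : `|c x| <= T.
  by rewrite /c ler_norml le_max lexx/= ge_max NTT ge_min lexx orbT.
have cE x : `|x| <= T -> c x = x.
  by rewrite ler_norml /c => /andP[? ?]; rewrite min_l// max_r.
have c_nd x y : x <= y -> 0 <= c y - c x <= y - x.
  rewrite /c => xy; case: (leP x T) => xT; case: (leP y T) => yT; try lra.
  - by case: (leP (- T) x) => Tx; case: (leP (- T) y) => Ty; lra.
  - by case: (leP (- T) x) => Tx; rewrite max_r//; lra.
pose F x := f (c x) + L' * x.
have F_incr x y : x <= y -> 0 <= F y - F x <= 2 * L' * (y - x).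
  move=> xy; have /andP[c0 c1] := c_nd _ _ xy.
  have := fL _ _ (cT y) (cT x); rewrite (ger0_norm c0) ler_norml => /andP[f0 f1].
  have : L * (c y - c x) <= L * (y - x) by rewrite ler_wpM2l.
  by rewrite /F /L' => Lc; apply/andP; split; nra.
have F_nd : {homo F : x y / x <= y}.
  by move=> x y /F_incr/andP[]; rewrite subr_ge0.
have L'0 : 0 < 2 * L' by rewrite /L'; lra.
have FL' x y : x <= y -> F y - F x <= 2 * L' * (y - x) by move=> /F_incr/andP[].
have [phi [phii phi1 phi2]] := lipschitz_density L'0 NTT F_nd FL'.
have mphi : measurable_fun setT phi by apply/measurable_EFinP; have /integrableP[] := phii.
exists (fun x => phi x - L'); split.
- exact: measurable_funB.
- move=> x y Tx xy yT.
  have mxy : measurable (`[x, y]%classic : set (measurableTypeR R)) by exact: measurable_itv.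
  have muxy : mu `[x, y]%classic = (y - x)%:E.
    rewrite lebesgue_measure_itv/= lte_fin; case: ifPn => // yx.
    rewrite -leNgt in yx; have -> : x = y by apply/le_anti/andP.
    by rewrite subrr.
  under eq_integral do rewrite EFinB.
  rewrite integralB//; last 2 first.
  + exact: integrableS phii.
  + apply: measurable_bounded_integrable => //; last exact: bounded_cst.
    by rewrite [X in (X < _)%E]muxy ltry.
  have cstI : (\int[mu]_(s in `[x, y]) L'%:E)%E = (L' * (y - x))%:E.
    by rewrite integral_cst// [X in (_ * X)%E]muxy.
  rewrite [X in (X - _)%E]phi1// [X in (_ - X)%E]cstI -EFinB; congr (_%:E).
  rewrite /F !cE; first ring.
  + by rewrite ler_norml Tx (le_trans xy).
  + by rewrite ler_norml yT (le_trans Tx).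
- have locphi : locally_integrable setT phi by apply: open_integrable_locally => //; exact: openT.
  have phiiNy (y : R) : mu.-integrable `]-oo, y] (EFin \o phi).
    by apply: integrableS phii => //; exact: measurable_itv.
  have := FTC1Ny phiiNy locphi.
  apply: filterS; first exact: (ae_filter_ringOfSetsType mu).
  move=> x [dx xE] xT.
  pose Phi y := \int[mu]_(t in [set` `]-oo, y]]) phi t.
  have : dyadic_quotient Phi x n - L' @[n --> \oo] --> phi x - L'.
    by apply: cvgB; [rewrite -xE; exact: derivable_dyadic_quotient|exact: cvg_cst].
  apply: cvg_trans; apply: near_eq_cvg; near=> n.
  have sn : dyadic_step n < T - `|x|.
    by near: n; apply: near_dyadic_step; rewrite subr_gt0.
  have s0 := dyadic_step_gt0 n.
  have xsT : `|x + dyadic_step n| <= T.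
    by rewrite (le_trans (ler_normD _ _))// [in X in _ + X]gtr0_norm//; lra.
  move: (xT) (xsT); rewrite ltr_norml ler_norml => /andP[x1 x2] /andP[x3 x4].
  rewrite /dyadic_quotient /Phi !phi2 ?(ltW x1) ?(ltW x2)//.
  rewrite /F (cE _ xsT) (cE _ (ltW xT)) (cE (- T)) ?normrN ?ger0_norm//.
  by field; rewrite gt_eqF.
Unshelve. all: by end_near. Qed.

End dyadic_quotient.

(** * Lebesgue measure and its completion *)

Section completed_lebesgue.
Context {R : realType}.
Local Notation mu := (@lebesgue_measure R).
Local Notation cmu := (@completed_lebesgue_measure R).

(** Completing a measure creates no new null sets: a set that is measurable for
the completion is a Borel set up to a subset of a Borel null set. *)
Lemma completed_negligibleP (N : set R) :
  cmu.-negligible (N : set (lebesgue_type R)) <-> mu.-negligible N.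
Proof.
split=> [[A [mA A0 NA]]|[A [mA A0 NA]]]; last first.
  by exists A; split => //; exact: sub_caratheodory.
have : completed_algebra_gen mu A.
  by rewrite -g_sigma_completed_algebra_genE completed_caratheodory_measurable.
move=> [/= B mB [N' negN'] BNA].
have B0 : mu B = 0%E.
  apply/eqP; rewrite eq_le measure_ge0 andbT -A0.
  by apply: le_outer_measure; rewrite -BNA; exact: subsetUl.
apply: (@negligibleS _ _ _ mu A N NA); rewrite -BNA; apply: negligibleU => //.
exact/negligibleP.
Qed.

Lemma lebesgue_negligibleN (N : set R) : mu.-negligible N ->
  mu.-negligible [set x | N (- x)].
Proof.
move=> [A [mA A0 NA]]; exists [set x | A (- x)]; split; last by move=> x /NA.
- rewrite -[X in measurable X]setTI.
  by apply: (@oppr_measurable R setT) => //.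
- rewrite -A0; apply/esym.
  have mN : measurable_fun setT (-%R : measurableTypeR R -> measurableTypeR R).
    exact: oppr_measurable.
  apply: (@lebesgue_measure_unique R
    (measure_function_pushforward__canonical__measure_function_Measure mu mN)) => //.
  move=> _ [[a b] _ <-].
  rewrite /= /pushforward.
  rewrite (_ : _ @^-1` _ = `[- b, - a[%classic); last first.
    by apply/seteqP; split=> x /=; rewrite !in_itv/= lerNl ltrNr andbC.
  by rewrite !lebesgue_measure_itv/= !lte_fin ltrN2 -!EFinD opprK addrC.
Qed.

(** Lebesgue measure is the image of its completion under the identity, viewed
as a map from the completed to the Borel sigma-algebra. *)
Let ge0_completed_integral (D : set R) (f : R -> \bar R) :
  measurable (D : set (measurableTypeR R)) ->
  measurable_fun (D : set (measurableTypeR R)) f -> (forall x, 0 <= f x)%E ->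
  (\int[cmu]_(x in (D : set (lebesgue_type R))) f x = \int[mu]_(x in D) f x)%E.
Proof.
move=> mD mf f0.
have mid : measurable_fun setT (idfun : lebesgue_type R -> measurableTypeR R).
  by move=> _ A mA; rewrite setTI; exact: sub_caratheodory.
have := @ge0_integral_pushforward _ _ (lebesgue_type R) (measurableTypeR R) R
  idfun mid cmu D f mD mf (fun x _ => f0 x).
by rewrite preimage_id => <-.
Qed.

Lemma completed_integral (D : set R) (f : R -> \bar R) :
  measurable (D : set (measurableTypeR R)) ->
  measurable_fun (D : set (measurableTypeR R)) f ->
  (\int[cmu]_(x in (D : set (lebesgue_type R))) f x = \int[mu]_(x in D) f x)%E.
Proof.
move=> mD mf; rewrite integralE [RHS]integralE; congr (_ - _)%E.
  by apply: ge0_completed_integral => //; exact: measurable_funepos.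
by apply: ge0_completed_integral => //; exact: measurable_funeneg.
Qed.

Lemma completed_itv (x y : R) (b0 b1 : bool) : x <= y ->
  cmu ([set` Interval (BSide b0 x) (BSide b1 y)] : set (lebesgue_type R)) = (y - x)%:E.
Proof.
move=> xy; rewrite [LHS](_ : _ = mu [set` Interval (BSide b0 x) (BSide b1 y)])//.
rewrite lebesgue_measure_itv/= lte_fin; case: ifPn => // yx.
rewrite -leNgt in yx; have -> : x = y by apply/le_anti/andP.
by rewrite subrr.
Qed.

Lemma measurable_lebesgue_itv (i : interval R) :
  measurable ([set` i] : set (lebesgue_type R)).
Proof. by apply: sub_caratheodory; exact: measurable_itv. Qed.

Lemma measurable_fun_lebesgue (D : set R) (f : R -> R) :
  measurable (D : set (measurableTypeR R)) ->
  measurable_fun (D : set (measurableTypeR R)) f ->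
  measurable_fun (D : set (lebesgue_type R)) (f : lebesgue_type R -> R).
Proof. by move=> mD mf _ Y mY; apply: sub_caratheodory; exact: mf. Qed.

End completed_lebesgue.

(** * Increments of an indefinite integral *)

Lemma measurable_sym_itv (R : realType) (alpha : \bar R) :
  measurable (sym_itv alpha : set (measurableTypeR R)).
Proof. exact: open_measurable (@open_sym_itv R alpha). Qed.

Section primitive.
Context {R : realType} (alpha : \bar R) (f g : R -> R).
Local Notation cmu := (@completed_lebesgue_measure R).
Hypothesis gPsi1 : Psi1 alpha g.
Hypothesis fE : forall t, sym_itv alpha t ->
  (f t - f 0)%:E = oriented_integral g t.

Lemma pos_itvP (x : R) : pos_itv alpha x <-> 0 < x /\ sym_itv alpha x.
Proof.
rewrite sym_itvP /pos_itv/= lte_fin; split=> [/andP[x0 xa]|[x0 xa]].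
  by rewrite gtr0_norm.
by rewrite x0/=; move: xa; rewrite gtr0_norm.
Qed.

Let g_ge0 x : pos_itv alpha x -> 0 <= g x.
Proof. by case: gPsi1 => _ [+ _ _] _; exact. Qed.

Let g_nd x y : pos_itv alpha x -> pos_itv alpha y -> x <= y -> g x <= g y.
Proof. by case: gPsi1 => _ [_ + _] _; exact. Qed.

Let sym_itvSr (m x : R) : pos_itv alpha m -> `|x| <= m -> sym_itv alpha x.
Proof.
move=> /pos_itvP[m0 ma] xm; apply: sym_itvS ma.
by rewrite (gtr0_norm m0).
Qed.

(** The bound for negative arguments comes from the almost everywhere inequality
[`|g (- t)| <= g t], reflected; the origin, where [g] is arbitrary, is null. *)
Let g_ae_bounded (m : R) : pos_itv alpha m ->
  {ae cmu, forall x : lebesgue_type R, `|x : R| <= m -> `|g x| <= g m}.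
Proof.
move=> ma; have /pos_itvP[m0 msym] := ma.
have [_ _ g_refl] := gPsi1.
have g_reflN : {ae cmu, forall x : lebesgue_type R,
    pos_itv alpha (- (x : R)) -> `|g x| <= g (- (x : R))}.
  have /completed_negligibleP/lebesgue_negligibleN/completed_negligibleP := g_refl.
  by apply: negligibleS => x /=; rewrite opprK.
have ne0 : {ae cmu, forall x : lebesgue_type R, (x : R) != 0}.
  exists ([set 0] : set R); split.
  - by apply: sub_caratheodory; exact: measurable_set1.
  - by rewrite -set_itv1 completed_itv// subrr.
  - by move=> x /= /negP; rewrite negbK => /eqP.
apply: (@filterS2 _ _ _ _ _ _ _ ne0 g_reflN).
move=> x x0 xN xm.
have xa := sym_itvSr ma xm.
have [xp|xn] := ltP 0 (x : R).
  have pa : pos_itv alpha x by apply/pos_itvP.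
  by rewrite ger0_norm ?g_ge0// g_nd// (le_trans (ler_norm _)).
have {}xn : (x : R) < 0 by rewrite lt_neqAle x0.
have pa : pos_itv alpha (- (x : R)).
  apply/pos_itvP; rewrite oppr_gt0; split => //.
  by apply: sym_itvS xa; rewrite normrN.
by rewrite (le_trans (xN pa))// g_nd// -ltr0_norm.
Qed.

Let g_measurable (A : set (lebesgue_type R)) : measurable A ->
  (A `<=` sym_itv alpha) ->
  measurable_fun A (EFin \o (g : lebesgue_type R -> R)).
Proof.
move=> mA Aa; apply/measurable_EFinP; have [+ _ _] := gPsi1.
apply: measurable_funS => //.
by apply: sub_caratheodory; exact: measurable_sym_itv.
Qed.

Let integral_bounded (m x y : R) (b0 b1 : bool) : pos_itv alpha m ->
  `|x| <= m -> `|y| <= m -> x <= y ->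
  (`| \int[cmu]_(s in [set` Interval (BSide b0 x) (BSide b1 y)]) (g s)%:E |
    <= (g m * (y - x))%:E)%E.
Proof.
move=> ma xm ym xy; set A : set (lebesgue_type R) := [set` _].
have mA : measurable A by exact: measurable_lebesgue_itv.
have Am z : A z -> `|z : R| <= m.
  move: xm ym; rewrite /A/= !ler_norml itv_boundlr/= => /andP[? ?] /andP[? ?] /andP[].
  by case: (b0); case: (b1); rewrite !bnd_simp => ? ?; apply/andP; split; lra.
have mg : measurable_fun A (EFin \o (g : lebesgue_type R -> R)).
  by apply: g_measurable => // z /Am; exact: sym_itvSr.
apply: (le_trans (le_abse_integral _ mA mg)).
apply: (@le_trans _ _ ((g m)%:E * cmu A)%E).
  apply: integral_le_bound => //; first by rewrite lee_fin g_ge0.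
  have := g_ae_bounded ma.
  by apply: filterS => z + /Am; exact.
by rewrite /A completed_itv// EFinM.
Qed.

Let sym_itv_cc x y z : sym_itv alpha x -> sym_itv alpha y ->
  x <= z <= y -> sym_itv alpha z.
Proof.
move=> /andP[xa _] /andP[_ ya] /andP[xz zy]; apply/andP; split.
  by apply: lt_le_trans xa _; rewrite lee_fin.
by apply: le_lt_trans ya; rewrite lee_fin.
Qed.

Let itv_sub_sym x y (b0 b1 : bool) : sym_itv alpha x -> sym_itv alpha y ->
  [set` Interval (BSide b0 x) (BSide b1 y)] `<=` sym_itv alpha.
Proof.
move=> xa ya z zxy; apply: (sym_itv_cc xa ya).
move: zxy; rewrite /= itv_boundlr => /andP[].
by case: b0; case: b1; rewrite !bnd_simp => ? ?; apply/andP; split=> //; exact: ltW.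
Qed.

Let sym_itv0 x : sym_itv alpha x -> sym_itv alpha 0.
Proof. by apply: sym_itvS; rewrite normr0. Qed.

Let increment_pos x y : 0 <= x -> x <= y -> sym_itv alpha y ->
  (f y - f x)%:E = (\int[cmu]_(s in `]x, y]) (g s)%:E)%E.
Proof.
move=> x0 xy ya.
have xa : sym_itv alpha x by apply: sym_itvS ya; rewrite !ger0_norm// (le_trans x0).
rewrite (_ : f y - f x = (f y - f 0) - (f x - f 0)); last by ring.
rewrite EFinB !fE// /oriented_integral x0 (le_trans x0 xy).
have E : (`[0, y] = `[0, x] `|` `]x, y])%classic.
  by rewrite -itv_bndbnd_setU// bnd_simp.
rewrite E integral_setU; first last.
- by apply/disj_setPLR => z/=; rewrite !in_itv/= => /andP[_ zx]; rewrite ltNge zx.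
- rewrite -E; apply: g_measurable; first exact: measurable_lebesgue_itv.
  exact: itv_sub_sym (sym_itv0 xa) ya.
- exact: measurable_lebesgue_itv.
- exact: measurable_lebesgue_itv.
have -> : (\int[cmu]_(s in `[0%R, x]) (g s)%:E = (f x - f 0)%:E)%E.
  by rewrite fE// /oriented_integral x0.
by rewrite addeAC subee// add0e.
Qed.

Let increment_neg x y : x <= y -> y <= 0 -> sym_itv alpha x ->
  (f y - f x)%:E = (\int[cmu]_(s in `[x, y[) (g s)%:E)%E.
Proof.
move=> xy y0 xa.
have ya : sym_itv alpha y by apply: sym_itvS xa; rewrite !ler0_norm ?lerN2// (le_trans xy).
have neg t : t <= 0 -> sym_itv alpha t ->
    (\int[cmu]_(s in `[t, 0%R]) (g s)%:E = (f 0 - f t)%:E)%E.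
  move=> t0 ta; rewrite -(opprB (f t)) EFinN fE// /oriented_integral.
  have [t0'|_] := leP 0 t; last by rewrite oppeK.
  have -> : t = 0 by apply/le_anti; rewrite t0.
  have cmu0 : cmu [set (0 : R)] = 0%E by rewrite -set_itv1 completed_itv// subrr.
  rewrite set_itv1 null_set_integral; first by rewrite oppe0.
  - by apply: sub_caratheodory; exact: measurable_set1.
  - apply: g_measurable.
      by apply: sub_caratheodory; exact: measurable_set1.
    by move=> _ ->; exact: sym_itv0 ta.
  - exact: cmu0.
rewrite (_ : f y - f x = (f 0 - f x) - (f 0 - f y)); last by ring.
rewrite EFinB -neg ?(le_trans xy)//.
have E : (`[x, 0] = `[x, y[ `|` `[y, 0])%classic.
  by rewrite -itv_bndbnd_setU// bnd_simp.
rewrite E integral_setU; first last.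
- by apply/disj_setPLR => z/=; rewrite !in_itv/= => /andP[_ zy]; rewrite leNgt zy.
- rewrite -E; apply: g_measurable; first exact: measurable_lebesgue_itv.
  exact: itv_sub_sym xa (sym_itv0 xa).
- exact: measurable_lebesgue_itv.
- exact: measurable_lebesgue_itv.
by rewrite neg// addeK.
Qed.

Lemma primitive_lipschitz (m x y : R) : pos_itv alpha m ->
  `|x| <= m -> `|y| <= m -> `|f y - f x| <= g m * `|y - x|.
Proof.
move=> ma; wlog xy : x y / x <= y => [h xm ym|xm ym].
  have [xy|/ltW yx] := leP x y; first exact: h.
  by rewrite distrC (distrC y); exact: h.
have xa := sym_itvSr ma xm; have ya := sym_itvSr ma ym.
have m0 : `|0 : R| <= m by rewrite normr0; case/pos_itvP : ma => /ltW.
have posE u v : 0 <= u -> u <= v -> `|u| <= m -> `|v| <= m ->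
    `|f v - f u| <= g m * (v - u).
  move=> u0 uv um vm; rewrite -lee_fin.
  have := integral_bounded false false ma um vm uv.
  by rewrite -increment_pos//; exact: sym_itvSr vm.
have negE u v : u <= v -> v <= 0 -> `|u| <= m -> `|v| <= m ->
    `|f v - f u| <= g m * (v - u).
  move=> uv v0 um vm; rewrite -lee_fin.
  have := integral_bounded true true ma um vm uv.
  by rewrite -increment_neg//; exact: sym_itvSr um.
rewrite [in leRHS]ger0_norm ?subr_ge0//.
have [x0|/ltW x0] := leP 0 x; first exact: posE.
have [y0|/ltW y0] := leP y 0; first exact: negE.
rewrite (_ : f y - f x = (f y - f 0) + (f 0 - f x)); last by ring.
rewrite (le_trans (ler_normD _ _))//.
by have := posE 0 y (lexx _) y0 m0 ym; have := negE x 0 x0 (lexx _) xm m0; lra.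
Qed.

Lemma primitive_increment_ge (c x y : R) : 0 <= c -> 0 <= x -> x <= y ->
  sym_itv alpha y -> (forall s, x < s <= y -> c <= g s) ->
  c * (y - x) <= f y - f x.
Proof.
move=> c0 x0 xy ya cg; rewrite -lee_fin increment_pos//.
have xa : sym_itv alpha x by apply: sym_itvS ya; rewrite !ger0_norm// (le_trans x0).
rewrite EFinM -(completed_itv false false xy) -integral_cst; last exact: measurable_lebesgue_itv.
apply: ge0_le_integral.
- exact: measurable_lebesgue_itv.
- by move=> s _; rewrite lee_fin.
- exact: measurable_cst.
- apply: g_measurable; first exact: measurable_lebesgue_itv.
  exact: itv_sub_sym xa ya.
- by move=> s; rewrite /= in_itv/= lee_fin; exact: cg.
Qed.

End primitive.

(** * From densities to increments *)

Section integrated_Phi.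
Context {R : realType} (alpha : \bar R) (f h : R -> R).
Hypothesis h_Phi : Phi alpha h.
Hypothesis f_lip : forall m x y, pos_itv alpha m -> `|x| <= m -> `|y| <= m ->
  `|f y - f x| <= h m * `|y - x|.
Hypothesis f_incr : forall c x y, 0 <= c -> 0 <= x -> x <= y ->
  sym_itv alpha y -> (forall s, x < s <= y -> c <= h s) ->
  c * (y - x) <= f y - f x.

Let f_nd x y : 0 <= x -> x <= y -> sym_itv alpha y -> f x <= f y.
Proof.
move=> x0 xy ya; have [h0 _ _] := h_Phi.
rewrite -subr_ge0 -(mul0r (y - x)); apply: f_incr => // s /andP[xs sy].
apply: h0; apply/pos_itvP; split; first exact: le_lt_trans x0 xs.
by apply: sym_itvS ya; rewrite !ger0_norm ?(le_trans x0) ?(ltW xs)// (le_trans (ltW xs)).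
Qed.

(** Both [x3] and [x3'] lie in [[-m, m]] for the geometric mean [m] of [x1] and
[x2], where the slope of [f] is at most [h m <= sqrt (h x1 * h x2)], while on
the diagonal the slopes to the right of [x1] and [x2] are at least [h x1] and
[h x2]. *)
Let segment_step (x1 x2 x3 x3' p q r : R) :
  0 <= x1 -> 0 <= x2 -> 0 <= p -> 0 <= q -> r ^+ 2 <= p * q ->
  x3 ^+ 2 <= x1 * x2 -> x3' ^+ 2 <= x1 * x2 -> x3' - x3 = r ->
  sym_itv alpha (x1 + p) -> sym_itv alpha (x2 + q) ->
  (f x3' - f x3) ^+ 2 <= (f (x1 + p) - f x1) * (f (x2 + q) - f x2).
Proof.
move=> x10 x20 p0 q0 rpq x3x x3'x x3r x1a x2a; have [h0 hnd hsqrt] := h_Phi.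
have x12 : 0 <= x1 * x2 by rewrite mulr_ge0.
pose m := Num.sqrt (x1 * x2).
have le_m z : z ^+ 2 <= x1 * x2 -> `|z| <= m by move=> zx; rewrite -sqrtr_sqr ler_wsqrtr.
have f1 : 0 <= f (x1 + p) - f x1 by rewrite subr_ge0 f_nd// lerDl.
have f2 : 0 <= f (x2 + q) - f x2 by rewrite subr_ge0 f_nd// lerDl.
have [m0|m0] := leP m 0.
  have z0 z : z ^+ 2 <= x1 * x2 -> z = 0.
    by move=> /le_m zm; apply/normr0_eq0/le_anti; rewrite normr_ge0 andbT (le_trans zm).
  by rewrite (z0 x3)// (z0 x3')// subrr expr0n mulr_ge0.
have x12p : 0 < x1 * x2 by rewrite -sqrtr_gt0.
have x1p : 0 < x1.
  by rewrite lt_neqAle x10 andbT; apply: contraTneq x12p => <-; rewrite mul0r ltxx.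
have x2p : 0 < x2.
  by rewrite lt_neqAle x20 andbT; apply: contraTneq x12p => <-; rewrite mulr0 ltxx.
have x1P : pos_itv alpha x1.
  by apply/pos_itvP; split => //; apply: sym_itvS x1a; rewrite !ger0_norm ?addr_ge0// lerDl.
have x2P : pos_itv alpha x2.
  by apply/pos_itvP; split => //; apply: sym_itvS x2a; rewrite !ger0_norm ?addr_ge0// lerDl.
have mP : pos_itv alpha m.
  apply/pos_itvP; split=> //.
  have /pos_itvP[_ x1s] := x1P; have /pos_itvP[_ x2s] := x2P.
  by apply: (sym_itv_geomean x1s x2s) => //; rewrite sqr_sqrtr.
have incr z p' : pos_itv alpha z -> 0 <= p' -> sym_itv alpha (z + p') ->
    h z * p' <= f (z + p') - f z.
  move=> zP p'0 za; have /pos_itvP[zp _] := zP.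
  rewrite -[X in _ * X](addKr z) (addrC (- z)); apply: f_incr => //; [exact: h0|exact: ltW|by rewrite lerDl|].
  move=> s /andP[zs szp]; apply: hnd => //; last exact: ltW.
  have s0 := lt_trans zp zs; apply/pos_itvP; split => //.
  by apply: sym_itvS za; rewrite !ger0_norm ?addr_ge0// ltW.
have hx1 := h0 _ x1P; have hx2 := h0 _ x2P; have hm := h0 _ mP.
apply: (@le_trans _ _ ((h m * `|r|) ^+ 2)).
  rewrite -[leLHS]real_normK ?num_real// ler_pXn2r// ?nnegrE ?mulr_ge0//.
  by rewrite -x3r f_lip// le_m.
apply: (@le_trans _ _ ((h x1 * p) * (h x2 * q))); last first.
  by apply: ler_pM; rewrite ?mulr_ge0// incr.
rewrite exprMn real_normK ?num_real// [leRHS]mulrACA ler_pM ?sqr_ge0//.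
by rewrite -(sqr_sqrtr (mulr_ge0 hx1 hx2)) ler_pXn2r// ?nnegrE// hsqrt.
Qed.

(** Cut the segment from [B] to [A] into [N.+1] pieces.  The off-diagonal increment
over all pieces but the last is controlled by the diagonal increments over all
pieces but the first, and these are at most the full diagonal increments; the
last off-diagonal piece vanishes as [N] grows, by the Lipschitz bound. *)
Lemma integrated_Phi_increment_psd : increment_psd alpha f.
Proof.
move=> b1 b2 c p q r b10 b20 cb p0 q0 rpq b1a b2a.
have f1 : f b1 <= f (b1 + p) by rewrite f_nd// lerDl.
have f2 : f b2 <= f (b2 + q) by rewrite f_nd// lerDl.
split=> //; set U := f (b1 + p) - f b1; set V := f (b2 + q) - f b2.
have UV0 : 0 <= U * V by rewrite mulr_ge0// subr_ge0.
have seg_psd s : 0 <= s -> (c + s * r) ^+ 2 <= (b1 + s * p) * (b2 + s * q).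
  move=> s0; apply: psd2D; rewrite ?mulr_ge0//.
  by rewrite exprMn [leRHS]mulrACA -expr2 ler_wpM2l// sqr_ge0.
have seg_sym b p' s : 0 <= b -> 0 <= p' -> 0 <= s <= 1 -> sym_itv alpha (b + p') ->
    sym_itv alpha (b + s * p').
  move=> bb p'0 /andP[s0 s1]; apply: sym_itvS; rewrite !ger0_norm ?addr_ge0 ?mulr_ge0//.
  by rewrite lerD2l ler_piMl.
(* shifting the diagonal by one step lets the bound at the right end of each
   subinterval serve as a lower bound on the next subinterval *)
have chain d k : 0 <= d -> k.+1%:R * d <= 1 ->
    [/\ 0 <= f (b1 + k.+1%:R * d * p) - f (b1 + d * p),
        0 <= f (b2 + k.+1%:R * d * q) - f (b2 + d * q) &
    (f (c + k%:R * d * r) - f c) ^+ 2 <=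
    (f (b1 + k.+1%:R * d * p) - f (b1 + d * p)) *
    (f (b2 + k.+1%:R * d * q) - f (b2 + d * q))].
  move=> d0; elim: k => [|k IH] kd.
    by rewrite !mul0r !mul1r addr0 !subrr mul0r expr0n.
  have kd' : k.+1%:R * d <= 1 by apply: le_trans kd; rewrite ler_wpM2r// ler_nat.
  have {IH}[IH1 IH2 IH3] := IH kd'.
  have kS : k.+2%:R * d = k.+1%:R * d + d by rewrite -[k.+2%:R]natr1 mulrDl mul1r.
  have kd0 : 0 <= k.+1%:R * d by rewrite mulr_ge0.
  have kd0' : 0 <= k%:R * d by rewrite mulr_ge0.
  have step : (f (c + k.+1%:R * d * r) - f (c + k%:R * d * r)) ^+ 2 <=
      (f (b1 + k.+2%:R * d * p) - f (b1 + k.+1%:R * d * p)) *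
      (f (b2 + k.+2%:R * d * q) - f (b2 + k.+1%:R * d * q)).
    have E b p' : b + k.+2%:R * d * p' = b + k.+1%:R * d * p' + d * p' by rewrite kS; ring.
    rewrite !E; apply: (@segment_step _ _ _ _ _ _ (d * r)); rewrite ?addr_ge0 ?mulr_ge0//.
    - by rewrite exprMn [leRHS]mulrACA -expr2 ler_wpM2l// sqr_ge0.
    - rewrite (le_trans (seg_psd _ kd0'))// ler_pM ?addr_ge0 ?mulr_ge0//.
        by rewrite lerD2l !ler_wpM2r// ler_nat.
      by rewrite lerD2l !ler_wpM2r// ler_nat.
    - exact: seg_psd.
    - by rewrite -natr1; ring.
    - by rewrite -E; apply: seg_sym => //; rewrite kd mulr_ge0.
    - by rewrite -E; apply: seg_sym => //; rewrite kd mulr_ge0.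
  have s1 : 0 <= f (b1 + k.+2%:R * d * p) - f (b1 + k.+1%:R * d * p).
    rewrite subr_ge0 f_nd ?addr_ge0 ?mulr_ge0//.
      by rewrite lerD2l !ler_wpM2r// ler_nat.
    by apply: seg_sym => //; rewrite kd mulr_ge0.
  have s2 : 0 <= f (b2 + k.+2%:R * d * q) - f (b2 + k.+1%:R * d * q).
    rewrite subr_ge0 f_nd ?addr_ge0 ?mulr_ge0//.
      by rewrite lerD2l !ler_wpM2r// ler_nat.
    by apply: seg_sym => //; rewrite kd mulr_ge0.
  have := psd2D IH1 IH2 IH3 s1 s2 step.
  have tel (u v w : R) : (v - u) + (w - v) = w - u by ring.
  by rewrite !tel => ?; split=> //; lra.
pose m := Num.max (b1 + p) (b2 + q).
have pb1 : 0 <= b1 + p by rewrite addr_ge0.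
have pb2 : 0 <= b2 + q by rewrite addr_ge0.
have [m0|m0] := leP m 0.
  move: m0; rewrite ge_max => /andP[m1 m2].
  have [r0 c0] : r = 0 /\ c = 0.
    have p00 : p = 0 by lra.
    have b00 : b1 = 0 by lra.
    by split; apply/eqP; rewrite -sqrf_eq0 eq_le sqr_ge0 andbT;
      [rewrite (le_trans rpq)// p00 mul0r|rewrite (le_trans cb)// b00 mul0r].
  by rewrite r0 addr0 subrr expr0n.
have mP : pos_itv alpha m.
  by apply/pos_itvP; split=> //; rewrite /m; case: leP.
have hm : 0 <= h m by have [h0 _ _] := h_Phi; apply: h0.
have seg_le_m s : 0 <= s <= 1 -> `|c + s * r| <= m.
  move=> /andP[s0 s1].
  have := @norm_geomean_le_max _ (c + s * r) (b1 + s * p) (b2 + s * q).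
  rewrite !addr_ge0 ?mulr_ge0// => /(_ isT isT (seg_psd _ s0)) /le_trans; apply.
  by rewrite /m ge_max !le_max !lerD2l !ler_piMl// orbT.
suff : `|f (c + r) - f c| <= Num.sqrt (U * V).
  move=> fUV; rewrite -[leLHS]real_normK ?num_real// -(sqr_sqrtr UV0).
  by rewrite ler_pXn2r ?nnegrE.
apply/ler_addgt0Pr => e e0.
pose N := Num.trunc (h m * `|r| / e); pose d : R := N.+1%:R^-1.
have d0 : 0 <= d by rewrite invr_ge0.
have Nd : N.+1%:R * d = 1 by rewrite mulfV.
have Nd1 : N%:R * d = 1 - d by move: Nd; rewrite -natr1 mulrDl mul1r; lra.
have Kd : h m * `|r| * d <= e.
  rewrite ler_pdivrMr// [leRHS]mulrC -ler_pdivrMr// ltW//.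
  by have /andP[] := trunc_itv (divr_ge0 (mulr_ge0 hm (normr_ge0 r)) (ltW e0)).
have d1 : d <= 1 by rewrite invf_le1// ler1n.
have Nd_le1 : N.+1%:R * d <= 1 by rewrite Nd.
have [_ _] := chain d N d0 Nd_le1; rewrite Nd Nd1 !mul1r => c3.
have xd b p' : 0 <= b -> 0 <= p' -> sym_itv alpha (b + p') ->
    0 <= f (b + p') - f (b + d * p') <= f (b + p') - f b.
  move=> b0 p'0 ba; have dp0 : 0 <= d * p' by rewrite mulr_ge0.
  have da : sym_itv alpha (b + d * p') by apply: seg_sym; rewrite ?d0.
  have fd : f b <= f (b + d * p') by apply: f_nd => //; rewrite lerDl.
  have fd1 : f (b + d * p') <= f (b + p').
    by apply: f_nd => //; rewrite ?addr_ge0// lerD2l ler_piMl.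
  by apply/andP; split; lra.
have /andP[x10 x1U] := xd _ _ b10 p0 b1a; have /andP[x20 x2V] := xd _ _ b20 q0 b2a.
have near_end : `|f (c + (1 - d) * r) - f c| <= Num.sqrt (U * V).
  by rewrite -sqrtr_sqr ler_wsqrtr// (le_trans c3)// ler_pM.
have last_step : `|f (c + r) - f (c + (1 - d) * r)| <= e.
  apply: le_trans Kd.
  have E : c + r - (c + (1 - d) * r) = d * r by ring.
  have := @f_lip m (c + (1 - d) * r) (c + r) mP.
  rewrite E normrM (ger0_norm d0) -mulrA (mulrC `|r|); apply.
    by apply: seg_le_m; lra.
  by rewrite -[r]mul1r; apply: seg_le_m; lra.
have := ler_normD (f (c + r) - f (c + (1 - d) * r)) (f (c + (1 - d) * r) - f c).
by rewrite addrA subrK; lra.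
Qed.

End integrated_Phi.

(** * From increments to densities *)

Section density.
Context {R : realType} (alpha : \bar R) (f : R -> R).
Local Notation mu := (@lebesgue_measure R).
Local Notation cmu := (@completed_lebesgue_measure R).
Hypothesis alpha_gt0 : (0 < alpha)%E.
Hypothesis f_psd : increment_psd alpha f.
Hypothesis f_out : forall x, ~ sym_itv alpha x -> f x = 0.

(** The limsup is measurable in [x] whether or not the quotients converge. *)
Definition dyadic_density (x : R) : R :=
  fine (limn_esup (fun n => (dyadic_quotient f x n)%:E)).

Local Notation g := dyadic_density.

Lemma cvg_dyadic_density x l : dyadic_quotient f x n @[n --> \oo] --> l -> g x = l.
Proof.
move=> fxl; rewrite /g.
have h : (dyadic_quotient f x n)%:E @[n --> \oo] --> l%:E by apply/cvg_EFin => //; exact: nearW.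
rewrite is_cvg_limn_esupE; last by apply/cvg_ex; exists l%:E.
by rewrite (cvg_lim _ h).
Qed.

Lemma measurable_increment_psd : measurable_fun setT f.
Proof.
have -> : f = f \_ (sym_itv alpha).
  by apply/funext => x; rewrite patchE; case: ifPn => // /negP; rewrite inE => /f_out.
have H := measurable_restrictT f (open_measurable (@open_sym_itv R alpha)).
apply: H.1.
apply: open_continuous_measurable_fun; first exact: open_sym_itv.
move=> x; rewrite inE => xa; have [T xT Ta] := sym_itv_room xa.
have T0 : 0 <= T by rewrite (le_trans _ (ltW xT)).
have [L L0 fL] := increment_psd_lipschitz f_psd T0 Ta.
apply/cvgrPdist_lt => e e0; near=> y.
have yT : `|y| <= T.
  have xy : `|x - y| < T - `|x|.
    by near: y; exists (T - `|x|) => //=; rewrite subr_gt0.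
  rewrite -(subrK x y) (le_trans (ler_normD _ _))// distrC.
  by move: xy; lra.
rewrite (le_lt_trans (fL _ _ (ltW xT) yT))//.
apply: (@le_lt_trans _ _ ((L + 1) * `|x - y|)); first by rewrite ler_wpM2r//; lra.
rewrite -ltr_pdivlMl; last lra.
by near: y; exists ((L + 1)^-1 * e) => //=; rewrite mulr_gt0// invr_gt0; lra.
Unshelve. all: by end_near. Qed.

Lemma measurable_dyadic_density : measurable_fun setT g.
Proof.
apply: measurableT_comp; first exact: fine_measurable.
apply: measurable_fun_limn_esup => n; apply/measurable_EFinP.
apply: measurable_funM => //; apply: measurable_funB; last exact: measurable_increment_psd.
apply: measurableT_comp; first exact: measurable_increment_psd.
exact: measurable_funD.
Qed.

Lemma near_step_sym x : sym_itv alpha x ->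
  \forall n \near \oo, sym_itv alpha (x + dyadic_step n).
Proof.
move=> xa; have [T xT Ta] := sym_itv_room xa.
have : 0 < T - `|x| by rewrite subr_gt0.
move=> /near_dyadic_step; apply: filterS => n sn; apply: sym_itvS Ta.
have s0 := @dyadic_step_gt0 R n.
rewrite (le_trans (ler_normD _ _))// (le_trans _ (ler_norm _))//.
by rewrite (gtr0_norm s0); lra.
Qed.

Let step_norm n : `|@dyadic_step R n| <= dyadic_step n.
Proof. by rewrite gtr0_norm// dyadic_step_gt0. Qed.

(** An increment over the right half of a dyadic step is at least the one over
the left half, so halving the step decreases the quotient. *)
Lemma pos_dyadic_quotient_cvg x : 0 <= x -> sym_itv alpha x ->
  dyadic_quotient f x n @[n --> \oo] --> g x.
Proof.
move=> x0 xa.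
have [N _ Nx] := near_step_sym xa.
have step_le n : (N <= n)%N -> dyadic_quotient f x n.+1 <= dyadic_quotient f x n.
  move=> Nn; rewrite /dyadic_quotient.
  have sS : @dyadic_step R n = dyadic_step n.+1 + dyadic_step n.+1.
    by rewrite /dyadic_step exprS; field.
  have s0 := @dyadic_step_gt0 R n.+1.
  have xs : `|x| <= x + dyadic_step n.+1 by rewrite ger0_norm// lerDl ltW.
  have xn : sym_itv alpha (x + dyadic_step n.+1 + dyadic_step n.+1).
    by rewrite -addrA -sS; exact: Nx.
  have := le_trans (ler_norm _) (increment_le f_psd xs (step_norm n.+1) xn).
  rewrite -addrA -sS => h.
  rewrite ler_pdivrMl// [in leRHS]sS.
  set u := dyadic_step n.+1 in s0 h *; rewrite [leRHS](_ : _ = (f (x + (u + u)) - f x) / 2).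
    by rewrite -sS; lra.
  by field; rewrite gt_eqF// addr_gt0.
have dq0 n : (N <= n)%N -> 0 <= dyadic_quotient f x n.
  have s0 := ltW (@dyadic_step_gt0 R n).
  move=> Nn; rewrite mulr_ge0// ?invr_ge0//.
  have xx : `|x| <= x by rewrite ger0_norm.
  by apply: le_trans (increment_le f_psd xx (step_norm n) (Nx _ Nn)).
have : cvgn (fun n => dyadic_quotient f x (n + N)).
  apply: nonincreasing_is_cvgn.
    by apply/nonincreasing_seqP => n; rewrite addSn step_le// leq_addl.
  by exists 0 => _ [n _ <-]; rewrite dq0// leq_addl.
move=> /cvg_ex[l]; rewrite (cvg_shiftn N) => fl.
by rewrite (cvg_dyadic_density fl).
Qed.

Lemma norm_dyadic_quotient_le c x : `|c| <= x -> sym_itv alpha x ->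
  \forall n \near \oo, `|dyadic_quotient f c n| <= dyadic_quotient f x n.
Proof.
move=> cx xa; have := near_step_sym xa; apply: filterS => n xn.
have s0 := ltW (@dyadic_step_gt0 R n).
rewrite /dyadic_quotient normrM ger0_norm ?invr_ge0// ler_wpM2l ?invr_ge0//.
have h := increment_le f_psd cx (step_norm n) xn.
exact: h.
Qed.

(** The square root inequality is the limit of the increment condition at the psd
matrix with entries [s], [sqrt (s * t)], [t], moved by the all-ones matrix. *)
Lemma dyadic_density_Phi : Phi alpha g.
Proof.
have cvg_pos x : pos_itv alpha x -> dyadic_quotient f x n @[n --> \oo] --> g x.
  by move=> /pos_itvP[x0]; apply: pos_dyadic_quotient_cvg; exact: ltW.
have g0 x : pos_itv alpha x -> 0 <= g x.
  move=> xP; have /pos_itvP[x0 xa] := xP.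
  have xx : `|x| <= x by rewrite gtr0_norm.
  apply: (ler_cvg_to (cvg_cst 0) (cvg_pos _ xP)).
  by have := norm_dyadic_quotient_le xx xa; apply: filterS => n; exact: le_trans.
split=> // s t sP tP.
- move=> st; apply: (ler_cvg_to (cvg_pos _ sP) (cvg_pos _ tP)).
  have /pos_itvP[s0 _] := sP; have /pos_itvP[t0 ta] := tP.
  have st' : `|s| <= t by rewrite gtr0_norm.
  have := norm_dyadic_quotient_le st' ta; apply: filterS => n.
  exact: le_trans (ler_norm _).
- have /pos_itvP[s0 sa] := sP; have /pos_itvP[t0 ta] := tP.
  have st0 : 0 <= s * t by rewrite mulr_ge0 ?ltW.
  have mP : pos_itv alpha (Num.sqrt (s * t)).
    apply/pos_itvP; split; first by rewrite sqrtr_gt0 mulr_gt0.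
    by apply: (sym_itv_geomean sa ta (ltW s0) (ltW t0)); rewrite sqr_sqrtr.
  rewrite -[leLHS](@ger0_norm _ (g _)) ?g0// -sqrtr_sqr ler_wsqrtr//.
  have cs : dyadic_quotient f s n * dyadic_quotient f t n @[n --> \oo] --> g s * g t.
    by apply: cvgM; exact: cvg_pos.
  have cm : dyadic_quotient f (Num.sqrt (s * t)) n ^+ 2 @[n --> \oo] -->
      g (Num.sqrt (s * t)) ^+ 2.
    by rewrite expr2; apply: cvgM; exact: cvg_pos.
  apply: (ler_cvg_to cm cs).
  have := near_step_sym sa; apply: filterS2 (near_step_sym ta) => n tn sn.
  have d0 := ltW (@dyadic_step_gt0 R n).
  have dd : dyadic_step n ^+ 2 <= dyadic_step n * dyadic_step n :> R by rewrite expr2.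
  have mm : Num.sqrt (s * t) ^+ 2 <= s * t by rewrite sqr_sqrtr.
  have [_ _] := f_psd (ltW s0) (ltW t0) mm d0 d0 dd sn tn.
  move=> h; rewrite /dyadic_quotient exprMn expr2 [leRHS]mulrACA.
  by rewrite ler_wpM2l// mulr_ge0// invr_ge0.
Qed.

Lemma dyadic_quotient_cvg_ae :
  {ae mu, forall x, sym_itv alpha x -> dyadic_quotient f x n @[n --> \oo] --> g x}.
Proof.
have [T Ta Tx] := sym_itv_exhaustion alpha_gt0.
have aeT k : {ae mu, forall x, `|x| < T k -> dyadic_quotient f x n @[n --> \oo] --> g x}.
  have [Tk0 Tka] := Ta k.
  have [L L0 fL] := increment_psd_lipschitz f_psd Tk0 Tka.
  have [psi [_ _ psiE]] := lipschitz_density_quotient L0 Tk0 fL.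
  apply: (@filterS _ _ (ae_filter_ringOfSetsType mu) _ _ _ psiE) => x xE xT.
  by have fx := xE xT; rewrite (cvg_dyadic_density fx).
apply: (@filterS _ _ (ae_filter_ringOfSetsType mu) _ _ _ (ae_foralln aeT)).
by move=> x xT xa; have [k xk] := Tx _ xa; exact: xT xk.
Qed.

Lemma dyadic_density_norm_le : {ae cmu, forall t : lebesgue_type R,
  pos_itv alpha (t : R) -> `|g (- (t : R))| <= g t}.
Proof.
have := dyadic_quotient_cvg_ae => /lebesgue_negligibleN/completed_negligibleP.
apply: negligibleS => x; apply: contra_not => /= H /pos_itvP[x0 xa].
have Nxx : `|- x| <= x by rewrite normrN gtr0_norm.
have Nxa : sym_itv alpha (- x) by apply: sym_itvS xa; rewrite normrN.
apply: (ler_cvg_to (cvg_norm (H Nxa)) (pos_dyadic_quotient_cvg (ltW x0) xa)).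
exact: norm_dyadic_quotient_le.
Qed.

Lemma dyadic_density_Psi1 : Psi1 alpha g.
Proof.
split; [|exact: dyadic_density_Phi|exact: dyadic_density_norm_le].
apply: measurable_fun_lebesgue; first exact: measurable_sym_itv.
by apply: measurable_funS measurable_dyadic_density.
Qed.

(** The strict bounds put the whole interval inside the open set where the density
of [f] on [[-T, T]] is the limit of its quotients. *)
Lemma integral_dyadic_density T x y : sym_itv alpha T ->
  - T < x -> x <= y -> y < T ->
  (\int[cmu]_(s in `[x, y]) (g s)%:E)%E = (f y - f x)%:E.
Proof.
move=> Ta Tx xy yT; have T0 : 0 <= T by lra.
have [L L0 fL] := increment_psd_lipschitz f_psd T0 Ta.
have [psi [mpsi psiI psiE]] := lipschitz_density_quotient L0 T0 fL.
rewrite -(psiI _ _ (ltW Tx) xy (ltW yT)).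
transitivity (\int[mu]_(s in `[x, y]) (g s)%:E)%E.
  apply: completed_integral; first exact: measurable_itv.
  by apply/measurable_EFinP; exact: measurable_funS measurable_dyadic_density.
apply: ae_eq_integral.
- exact: measurable_itv.
- apply/measurable_EFinP; exact: measurable_funS measurable_dyadic_density.
- apply/measurable_EFinP; exact: measurable_funS mpsi.
apply: (@filterS _ _ (ae_filter_ringOfSetsType mu) _ _ _ psiE) => z zE.
rewrite /= in_itv/= => /andP[xz zy].
by rewrite (cvg_dyadic_density (zE _))// ltr_norml; apply/andP; split; lra.
Qed.

Lemma increment_psd_Psi2 : Psi2 alpha f.
Proof.
exists g; first exact: dyadic_density_Psi1.
move=> t ta; have [T tT Ta] := sym_itv_room ta.
move: tT; rewrite ltr_norml => /andP[Tt tT].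
rewrite /oriented_integral; case: leP => t0.
  by rewrite (integral_dyadic_density Ta)//; lra.
by rewrite (integral_dyadic_density Ta) ?ltW//; [rewrite -EFinN opprB|lra].
Qed.

End density.

(** * The characterization *)

(** Lets [f] be replaced by zero outside the interval, which makes it Borel. *)
Lemma eq_increment_psd (R : realType) (alpha : \bar R) (f f' : R -> R) :
  (forall x, sym_itv alpha x -> f x = f' x) ->
  increment_psd alpha f -> increment_psd alpha f'.
Proof.
move=> ff' fi b1 b2 c p q r b10 b20 cb p0 q0 rpq b1a b2a.
have b1a' : sym_itv alpha b1.
  by apply: sym_itvS b1a; rewrite !ger0_norm ?addr_ge0// lerDl.
have b2a' : sym_itv alpha b2.
  by apply: sym_itvS b2a; rewrite !ger0_norm ?addr_ge0// lerDl.
have ca : sym_itv alpha c by exact: sym_itv_geomean cb.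
have cra : sym_itv alpha (c + r).
  by apply: (sym_itv_geomean b1a b2a); rewrite ?addr_ge0//; exact: psd2D.
rewrite -!ff'//; exact: fi.
Qed.

Theorem proposition2p3 (R : realType) (alpha : \bar R) (alpha_gt0 : (0 < alpha)%E) :
  S_mono 2 alpha = Psi2 alpha.
Proof.
apply/seteqP; split=> f.
- move=> /S_mono2P f_psd.
  pose f0 x := if `[< sym_itv alpha x >] then f x else 0.
  have f0E x : sym_itv alpha x -> f0 x = f x by move=> xa; rewrite /f0 asboolT.
  have f0_psd : increment_psd alpha f0.
    by apply: eq_increment_psd f_psd => x /f0E.
  have f0_out x : ~ sym_itv alpha x -> f0 x = 0 by move=> xa; rewrite /f0 asboolF.
  have [g g1 gE] := increment_psd_Psi2 alpha_gt0 f0_psd f0_out.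
  exists g => // t ta; rewrite -gE// !f0E//.
  by apply: sym_itvS ta; rewrite normr0.
- move=> [g g1 fE]; apply/S_mono2P; have [_ gPhi _] := g1.
  apply: (integrated_Phi_increment_psd gPhi).
  + by move=> m x y; exact: (primitive_lipschitz g1 fE).
  + by move=> c x y; exact: (primitive_increment_ge g1 fE).
Qed.
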